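(* The following three assertions hold. (i) The subdirectly irreducible distributive rotational lattices are, up to isomorphism, exactly the rotational cubes $\mathfrak{B}_n$, $n\in\mathbb{N}$. Moreover, each $\mathfrak{B}_n$ is simple. (ii) The varieties of distributive rotational lattices are exactly the varieties $\mathbf{Var}(X)$ with $X\in\mathcal{I}_{\mathrm{fin}}(\mathbb{N})$. For $X,Y\in\mathcal{I}_{\mathrm{fin}}(\mathbb{N})$, we have $\mathbf{Var}(X)\subseteq\mathbf{Var}(Y)$ if and only if $X\subseteq Y$. (iii) For every $n\in\mathbb{N}$, $\mathbf{DRL}(n)=\mathbf{Var}(\{x\in\mathbb{N}: x\text{ divides }n\})$.
   Context: Let $\mathbb{N}=\{1,2,3,\dots\}$. A rotational lattice is an algebra $\mathfrak{L}=\langle L;\vee,\wedge,g\rangle$ with binary operations $\vee,\wedge$ and a unary operation $g$, where $\langle L;\vee,\wedge\rangle$ is a (nonempty) lattice, $g$ is an automorphism of this lattice, and $g^n=\mathrm{id}_L$ for some $n\in\mathbb{N}$. It is distributive if the lattice $\langle L;\vee,\wedge\rangle$ is distributive. Subalgebras, congruences, homomorphisms, simplicity, subdirect irreducibility and varieties are understood in the sense of universal algebra in the signature $(\vee,\wedge,g)$. Simple and subdirectly irreducible algebras are required to have at least two elements. A variety of distributive rotational lattices is a variety in this signature all of whose members are distributive rotational lattices. For $n\in\mathbb{N}$, $\mathbf{DRL}(n)$ is the class of distributive rotational lattices satisfying the identity $g^n(x)\approx x$. For $n\in\mathbb{N}$, the $n$-dimensional rotational cube is $\mathfrak{B}_n=\langle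 B_n;\vee,\wedge,g\rangle$, where $B_n$ is the boolean lattice with $2^n$ elements, with atoms $a_0,\dots,a_{n-1}$, and $g$ is the lattice automorphism of $B_n$ determined by $g(a_i)=a_{i+1}$, subscripts modulo $n$. $\mathcal{I}_{\mathrm{fin}}(\mathbb{N})$ is the set of finite order ideals of $\mathbb{N}$ under divisibility: $X\subseteq\mathbb{N}$ belongs to it iff $X$ is finite and, for all $x,y\in\mathbb{N}$, $x\in X$ and $y\mid x$ imply $y\in X$ (so $\varnothing\in\mathcal{I}_{\mathrm{fin}}(\mathbb{N})$). For $X\in\mathcal{I}_{\mathrm{fin}}(\mathbb{N})$, $\mathbf{Var}(X)$ is the variety generated by $\{\mathfrak{B}_n:n\in X\}$; $\mathbf{Var}(\varnothing)$ is the class of one-element algebras. *)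

(* Defs.v *)
From Corelib Require RelationClasses.
From mathcomp Require Import all_boot.
From mathcomp Require Import boolp classical_sets cardinality.

Set Implicit Arguments.
Unset Strict Implicit.
Unset Printing Implicit Defensive.

(* Arbitrary algebras in the signature (join, meet, g), with no identities
   imposed. The universe of an algebra is nonempty. *)
Record algebra := Algebra {
  carrier :> Type;
  join : carrier -> carrier -> carrier;
  meet : carrier -> carrier -> carrier;
  gop : carrier -> carrier;
  carrier_inh : inhabited carrier
}.

Definition nontrivial (A : algebra) : Prop := exists x y : A, x <> y.

(** Universal algebra *)

Definition is_hom (A B : algebra) (f : A -> B) : Prop :=
  [/\ {morph f : x y / join x y >-> join x y},
      {morph f : x y / meet x y >-> meet x y}
    & {morph f : x / gop x >-> gop x}].

Definition is_surjective (A B : Type) (f : A -> B) : Prop :=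
  forall y, exists x, f x = y.

Definition is_iso (A B : algebra) (f : A -> B) : Prop :=
  is_hom f /\ bijective f.

Definition isomorphic (A B : algebra) : Prop :=
  exists f : A -> B, is_iso f.

Definition subuniverse (A : algebra) (P : A -> Prop) : Prop :=
  [/\ exists x, P x,
      forall x y, P x -> P y -> P (join x y),
      forall x y, P x -> P y -> P (meet x y)
    & forall x, P x -> P (gop x)].

Section Subalgebra.
Variables (A : algebra) (P : A -> Prop) (hP : subuniverse P).

Definition sub_join (x y : {x : A | P x}) : {x : A | P x} :=
  exist P (join (sval x) (sval y))
    (let: And4 _ hj _ _ := hP in hj _ _ (svalP x) (svalP y)).

Definition sub_meet (x y : {x : A | P x}) : {x : A | P x} :=
  exist P (meet (sval x) (sval y))
    (let: And4 _ _ hm _ := hP in hm _ _ (svalP x) (svalP y)).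

Definition sub_gop (x : {x : A | P x}) : {x : A | P x} :=
  exist P (gop (sval x)) (let: And4 _ _ _ hg := hP in hg _ (svalP x)).

Lemma sub_inh : inhabited {x : A | P x}.
Proof. by case: hP => -[x Px] _ _ _; exact: (inhabits (exist P x Px)). Qed.

Definition subalgebra : algebra := Algebra sub_join sub_meet sub_gop sub_inh.

End Subalgebra.

Section Product.
Variables (I : Type) (A : I -> algebra).

Lemma prod_inh : inhabited (forall i, A i).
Proof.
have ex i : exists x : A i, True by case: (carrier_inh (A i)) => x; exists x.
exact: (inhabits (fun i => sval (cid (ex i)))).
Qed.

Definition product : algebra :=
  Algebra (carrier := forall i, A i)
    (fun x y i => join (x i) (y i))
    (fun x y i => meet (x i) (y i))
    (fun x i => gop (x i))
    prod_inh.

End Product.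

Definition congruence (A : algebra) (th : A -> A -> Prop) : Prop :=
  [/\ RelationClasses.Equivalence th,
      forall x x' y y', th x x' -> th y y' -> th (join x y) (join x' y'),
      forall x x' y y', th x x' -> th y y' -> th (meet x y) (meet x' y')
    & forall x x', th x x' -> th (gop x) (gop x')].

Definition simple (A : algebra) : Prop :=
  nontrivial A /\
  forall th : A -> A -> Prop, congruence th ->
    (forall x y, th x y <-> x = y) \/ (forall x y, th x y).

Definition subdirect_embedding (A : algebra) (I : Type) (B : I -> algebra)
    (f : A -> product B) : Prop :=
  [/\ is_hom f, injective f & forall i, is_surjective (fun x => f x i)].

Definition subdirectly_irreducible (A : algebra) : Prop :=
  nontrivial A /\
  forall (I : Type) (B : I -> algebra) (f : A -> product B),
    subdirect_embedding f -> exists i, is_iso (fun x => f x i).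

(* Closure under H, S and P. The empty index type is allowed in P, so that a
   variety always contains the one-element algebras. *)
Definition variety (V : algebra -> Prop) : Prop :=
  [/\ forall (A B : algebra) (f : A -> B),
        is_hom f -> is_surjective f -> V A -> V B,
      forall (A : algebra) (P : A -> Prop) (hP : subuniverse P),
        V A -> V (subalgebra hP)
    & forall (I : Type) (A : I -> algebra),
        (forall i, V (A i)) -> V (product A)].

Definition generated_variety (K : algebra -> Prop) (A : algebra) : Prop :=
  forall V : algebra -> Prop,
    variety V -> (forall B, K B -> V B) -> V A.

(** Rotational lattices *)

Definition lattice (A : algebra) : Prop :=
  [/\ commutative (@join A) /\ commutative (@meet A),
      associative (@join A) /\ associative (@meet A)
    & (forall x y : A, join x (meet x y) = x) /\
      (forall x y : A, meet x (join x y) = x)].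

Definition lattice_automorphism (A : algebra) (f : A -> A) : Prop :=
  [/\ bijective f, {morph f : x y / join x y} & {morph f : x y / meet x y}].

Definition rotational_lattice (A : algebra) : Prop :=
  [/\ lattice A, lattice_automorphism (@gop A)
    & exists n : nat, 0 < n /\ forall x : A, iter n (@gop A) x = x].

Definition distributive_rotational_lattice (A : algebra) : Prop :=
  rotational_lattice A /\
  forall x y z : A, meet x (join y z) = join (meet x y) (meet x z).

Definition DRL (n : nat) (A : algebra) : Prop :=
  distributive_rotational_lattice A /\ forall x : A, iter n (@gop A) x = x.

Definition variety_of_DRLs (V : algebra -> Prop) : Prop :=
  variety V /\ forall A, V A -> distributive_rotational_lattice A.

(* The boolean lattice with 2^n elements is realised as the subsets of 'I_n,
   whose atoms are the singletons; ordS is i |-> i + 1 modulo n. *)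
Definition cube (n : nat) : algebra :=
  Algebra (carrier := {set 'I_n})
    (fun x y => x :|: y) (fun x y => x :&: y) (fun x => @ordS n @: x)
    (inhabits finset.set0).

(* Subsets of {1, 2, 3, ...} are sets of naturals not containing 0. *)
Definition fin_div_ideal (X : set nat) : Prop :=
  [/\ forall x, X x -> 0 < x, finite_set X
    & forall x y, X x -> y %| x -> X y].

Definition Var (X : set nat) : algebra -> Prop :=
  generated_variety (fun A => exists n, X n /\ A = cube n).

(* Main.v *)
Require Import Defs.
From mathcomp Require Import all_boot.
From mathcomp Require Import boolp classical_sets cardinality.
From mathcomp Require Import zify.

Set Implicit Arguments.
Unset Strict Implicit.
Unset Printing Implicit Defensive.

(** Let [g^n = id] and let [F] be a prime filter of a distributive lattice. The
    translates of [F] under [g] are finitely many and pairwise incomparable, so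
    if [d] is the size of this orbit then the map sending [x] to the set of
    translates containing [x] is a homomorphism onto the whole cube [B_d], and
    [d %| n]. As prime filters separate points, every distributive rotational
    lattice is a subdirect product of cubes which are its quotients; everything
    else follows from the simplicity of cubes and from an identity telling
    apart [B_n] from the [B_k] with [k] not divisible by [n]. *)

(** * Prime filters *)

Section PrimeFilter.
Variables (L : algebra) (latL : lattice L).
Hypothesis meet_joinr : forall x y z : L,
  meet x (join y z) = join (meet x y) (meet x z).

Local Notation le x y := (meet x y = x).

Lemma meetC : commutative (@meet L). Proof. by case: latL => -[]. Qed.
Lemma joinC : commutative (@join L). Proof. by case: latL => -[]. Qed.
Lemma meetA : associative (@meet L). Proof. by case: latL => _ []. Qed.
Lemma joinKmeet (x y : L) : join x (meet x y) = x.
Proof. by case: latL => _ _ []. Qed.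
Lemma meetKjoin (x y : L) : meet x (join x y) = x.
Proof. by case: latL => _ _ []. Qed.
Lemma meetxx (x : L) : meet x x = x.
Proof. by rewrite -{2}(joinKmeet x x) meetKjoin. Qed.
Lemma le_trans (x y z : L) : le x y -> le y z -> le x z.
Proof. by move=> xy yz; rewrite -xy -meetA yz. Qed.
Lemma le_meetl (x y : L) : le (meet x y) x.
Proof. by rewrite meetC meetA meetxx. Qed.
Lemma le_meetr (x y : L) : le (meet x y) y.
Proof. by rewrite -meetA meetxx. Qed.
Lemma le_meet (x y z : L) : le x y -> le x z -> le x (meet y z).
Proof. by move=> xy xz; rewrite meetA xy xz. Qed.
Lemma le_joinl (x y : L) : le x (join x y). Proof. exact: meetKjoin. Qed.
Lemma le_joinr (x y : L) : le y (join x y).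
Proof. by rewrite joinC meetKjoin. Qed.

Definition lattice_filter (F : set L) : Prop :=
  (forall x y, F x -> F y -> F (meet x y)) /\
  (forall x y, F x -> le x y -> F y).

(** For nonempty [F] this is the filter generated by [F] and [a], the extension against which
    maximality is tested. *)
Lemma filter_adjoin (F : set L) (a : L) :
  lattice_filter F ->
  lattice_filter (fun z => exists2 m, F m & le (meet m a) z).
Proof.
move=> [Fm Fle]; split=> [x y [m Fx mx] [k Fy ky]|x y [m Fx mx] xy]; last first.
  by exists m => //; exact: le_trans mx xy.
exists (meet m k); first exact: Fm.
have mono (u v : L) : le u v -> le (meet u a) (meet v a).
  by move=> uv; apply: le_meet (le_meetr _ _); apply: le_trans (le_meetl _ _) uv.
apply: le_meet.
  exact: le_trans (mono _ _ (le_meetl _ _)) mx.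
exact: le_trans (mono _ _ (le_meetr _ _)) ky.
Qed.

(** A filter [M] maximal among those avoiding [y] is prime: if it omits [a] and [b], adjoining
    either captures [y], so [meet m a] and [meet k b] lie below [y] for some [m], [k] in [M], and by
    distributivity so does [meet (meet m k) (join a b)]. *)
Lemma prime_filter_exists (x y : L) : ~ le x y ->
  exists F : set L, [/\ lattice_filter F, F x, ~ F y
    & forall a b, F (join a b) -> F a \/ F b].
Proof.
move=> nxy.
(* The empty set is allowed so that the union of the empty chain qualifies. *)
pose P (F : set L) := [/\ lattice_filter F, ~ F y & forall z, F z -> F x].
have [|M [[fM nMy Mx] maxM]] := @Zorn_bigcup L P.
  move=> C CP totC; split.
  - split=> [a b [F CF Fa] [G CG Gb]|a b [F CF Fa] ab]; last first.
      by have [[_ Fle] _ _] := CP _ CF; exists F => //; exact: Fle ab.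
    have [[Fm _] _ _] := CP _ CF; have [[Gm _] _ _] := CP _ CG.
    by case: (totC _ _ CF CG) => sub;
      [exists G => //; apply: Gm => //|exists F => //; apply: Fm => //]; apply: sub.
  - by move=> [F CF Fy]; have [_ nFy _] := CP _ CF.
  - by move=> z [F CF Fz]; have [_ _ Fx] := CP _ CF; exists F => //; exact: Fx Fz.
have above (B : set L) : P B -> (forall z, M z -> B z) -> forall z, B z -> M z.
  move=> PB MB z Bz; apply: contrapT => nMz; apply: (maxM B) => //; split=> //.
  by move=> BM; apply: nMz; exact: BM.
(* An empty [M] would be properly extended by the principal filter of [x], which avoids [y]. *)
have {}Mx : M x.
  have fx : lattice_filter (fun z => le x z).
    by split=> [a b|a b xa ab]; [exact: le_meet|exact: le_trans xa ab].
  apply: contrapT => nMx; have M0 z : ~ M z by move=> /Mx.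
  apply: nMx; apply: (above (fun z => le x z)); last exact: meetxx.
    by split=> // z _; exact: meetxx.
  by move=> z /M0.
have [Mm Mle] := fM; exists M; split=> // a b Mab.
have bound c : ~ M c -> exists2 m, M m & le (meet m c) y.
  move=> nMc; apply: contrapT => ny; apply: nMc.
  apply: (above _ _ _ c).
  - split; [exact: filter_adjoin fM|exact: ny|].
    by move=> _ _; exists x => //; exact: le_meetl.
  - by move=> z Mz; exists z => //; exact: le_meetl.
  - by exists x => //; exact: le_meetr.
apply: contrapT => /not_orP[/bound[m Mm1 my] /bound[k Mk ky]].
apply: nMy; apply: (Mle (meet (meet m k) (join a b))); first exact: (Mm _ _ (Mm _ _ Mm1 Mk)).
have -> : meet (meet m k) (join a b)
        = join (meet k (meet m a)) (meet m (meet k b)).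
  by rewrite meet_joinr [meet k (meet m a)]meetA [meet k m]meetC [meet m (meet k b)]meetA.
rewrite [LHS]meetC meet_joinr; congr join.
  by rewrite meetC -meetA my.
by rewrite meetC -meetA ky.
Qed.

(** Of two distinct elements one is not below the other; [phi] is the indicator function of a prime
    filter containing the former but not the latter. *)
Lemma separating_character (x y : L) : x <> y ->
  exists phi : L -> bool, [/\ {morph phi : a b / join a b >-> a || b},
    {morph phi : a b / meet a b >-> a && b} & phi x != phi y].
Proof.
have main u v : ~ le u v ->
  exists phi : L -> bool, [/\ {morph phi : a b / join a b >-> a || b},
    {morph phi : a b / meet a b >-> a && b} & phi u && ~~ phi v].
  move=> /prime_filter_exists[F [[Fm Fle] Fu nFv Fj]].
  exists (fun z => `[< F z >]); split=> [a b|a b|].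
  - rewrite -asbool_or; apply: asbool_equiv_eq; split; first exact: Fj.
    by case=> [Fa|Fb]; [apply: Fle Fa _|apply: Fle Fb _];
      [exact: le_joinl|exact: le_joinr].
  - rewrite -asbool_and; apply: asbool_equiv_eq; split; last by case; exact: Fm.
    by move=> Fab; split; apply: Fle Fab _; [exact: le_meetl|exact: le_meetr].
  - by apply/andP; split; [exact/asboolP|exact/asboolPn].
move=> nxy; have [xy|/main[phi [pj pm /andP[px npy]]]] := pselect (le x y); last first.
  by exists phi; split=> //; rewrite px (negbTE npy).
have /main[phi [pj pm /andP[py npx]]] : ~ le y x.
  by move=> yx; apply: nxy; rewrite -xy meetC.
by exists phi; split=> //; rewrite py (negbTE npx).
Qed.

End PrimeFilter.

(** * Homomorphisms onto cubes *)

Section CubeQuotient.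
Variables (A : algebra) (n : nat).
Hypotheses (n_gt0 : 0 < n) (DRL_A : DRL n A).

Local Notation g := (@gop A).

Lemma gop_join : {morph g : x y / join x y}.
Proof. by case: DRL_A => -[[_ []]]. Qed.

Lemma gop_meet : {morph g : x y / meet x y}.
Proof. by case: DRL_A => -[[_ []]]. Qed.

Lemma iter_gop_join k : {morph iter k g : x y / join x y}.
Proof. by elim: k => // k IH x y; rewrite /= IH gop_join. Qed.

Lemma iter_gop_meet k : {morph iter k g : x y / meet x y}.
Proof. by elim: k => // k IH x y; rewrite /= IH gop_meet. Qed.

Lemma iter_gop_mul k x : iter (k * n) g x = x.
Proof.
have [_ gn] := DRL_A.
by elim: k => //= k IH; rewrite mulSn iterD IH.
Qed.

Variable phi : A -> bool.
Hypotheses (phiJ : {morph phi : a b / join a b >-> a || b})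
           (phiM : {morph phi : a b / meet a b >-> a && b}).

Definition period k := `[< forall z, phi (iter k g z) = phi z >].

Lemma periodP k : reflect (forall z, phi (iter k g z) = phi z) (period k).
Proof. exact: asboolP. Qed.

Lemma period_exponent : period n.
Proof. by have [_ gn] := DRL_A; apply/periodP => z; rewrite gn. Qed.

Lemma ex_period : exists k, (0 < k) && period k.
Proof. by exists n; rewrite n_gt0 period_exponent. Qed.

(** The number of distinct translates of [phi] under [g], hence the dimension of the cube built from
    [phi]. *)
Definition min_period := ex_minn ex_period.
Local Notation d := min_period.

Lemma min_period_gt0 : 0 < d.
Proof. by rewrite /d; case: ex_minnP => k /andP[]. Qed.

Lemma period_min : forall z, phi (iter d g z) = phi z.
Proof. by apply/periodP; rewrite /d; case: ex_minnP => k /andP[]. Qed.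

Lemma period_min_mul k z : phi (iter (k * d) g z) = phi z.
Proof. by elim: k => //= k IH; rewrite mulSn iterD period_min IH. Qed.

(** The remainder of [k] modulo [d] is again a period, hence zero by minimality. *)
Lemma min_period_dvd k : period k -> d %| k.
Proof.
move=> /periodP pk; rewrite /dvdn; case: posnP => [//|r_gt0].
have pr : period (k %% d).
  apply/periodP => z; rewrite -[RHS]pk {2}(divn_eq k d) iterD.
  exact/esym/period_min_mul.
have := ltn_pmod k min_period_gt0.
rewrite ltnNge => /negP[]; rewrite {1}/d; case: ex_minnP => m _ -> //.
by rewrite r_gt0 pr.
Qed.

(* The prime filters in an orbit of the finite-order map [g] form an antichain,
   since [F <= g^k F] iterates to [F <= g^k F <= ... <= g^(kn) F = F]. *)
Lemma period_of_le k :
  (forall z, phi z -> phi (iter k g z)) -> period k.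
Proof.
move=> lek; apply/periodP => z.
have up t w : phi w -> phi (iter (t * k) g w).
  by elim: t => //= t IH /IH /lek; rewrite mulSn iterD.
(* From [iter k g z], another [n.-1] rounds lead to [iter (n * k) g z], which is [z]. *)
apply/idP/idP => [/(up n.-1)|/lek //].
by rewrite -iterD addnC -mulSn prednK // mulnC iter_gop_mul.
Qed.

(** The exponent decreases with [i] because [gop] moves indices forward: [i.+1] lies in the image of
    [gop x] exactly when [i] lies in the image of [x]. *)
Definition cube_map (x : A) : cube d :=
  [set i : 'I_d | phi (iter (d - i) g x)]%SET.

Lemma cube_map_hom : is_hom cube_map.
Proof.
split=> [x y|x y|x]; apply/setP => i.
- by rewrite !inE iter_gop_join phiJ.
- by rewrite !inE iter_gop_meet phiM.
- rewrite -[i in RHS]ord_predK mem_imset; last exact: ordS_inj.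
  rewrite !inE -iterSr /=; case: i => -[|i] i_lt /=.
    (* The predecessor of index 0 wraps around to [d.-1]; the exponents [d.+1] and 1 agree under
       [phi] by periodicity. *)
    rewrite subn0 /= -iterS iterSr period_min add0n modn_small ?ltn_predL ?min_period_gt0 //.
    by case: (d) min_period_gt0 => //= e _; rewrite subSnn.
  rewrite modnDr modn_small; last exact: ltnW.
  by rewrite -iterS subnSK // ltnW.
Qed.

(** Otherwise one translate of [phi] would lie below another, making [n + i - j] a period; as [d]
    divides it and [n], [i] and [j] would coincide modulo [d]. *)
Lemma cube_map_separates (i j : 'I_d) : i != j ->
  exists z, (i \in (cube_map z : {set 'I_d})) && (j \notin (cube_map z : {set 'I_d})).
Proof.
move=> nij; apply: contrapT => nsep.
have le_dn : d <= n by apply: dvdn_leq => //; exact/min_period_dvd/period_exponent.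
have shift : period (n + i - j).
  apply: period_of_le => z pz; apply: contrapT => /negP npz; apply: nsep.
  (* The exponent is chosen so that coordinate [i] reads [phi z] and coordinate [j] reads
     [phi (iter (n + i - j) g z)]. *)
  exists (iter (n - (d - i)) g z); rewrite !inE -!iterD.
  have [_ gn] := DRL_A; have id_lt := ltn_ord i; have jd_lt := ltn_ord j.
  have -> : d - i + (n - (d - i)) = n by lia.
  have -> : d - j + (n - (d - i)) = n + i - j by lia.
  by rewrite gn pz.
have /dvdnP[q Eq] := min_period_dvd shift.
have /dvdnP[r Er] := min_period_dvd period_exponent.
move/eqP: nij; apply; apply: val_inj => /=.
rewrite -(modn_small (ltn_ord i)) -(modn_small (ltn_ord j)).
rewrite -(modnMDl r) -(modnMDl q j) -Eq -Er subnK //.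
by rewrite ltnW // (leq_trans (ltn_ord j)) // (leq_trans le_dn) ?leq_addr.
Qed.

Hypothesis phi_nonconst : exists x y, phi x && ~~ phi y.

Lemma cube_map_value (i : 'I_d) (x : A) :
  exists z, (i \in (cube_map z : {set 'I_d})) = phi x.
Proof.
exists (iter (n - (d - i)) g x); rewrite inE -iterD subnKC.
  by have [_ ->] := DRL_A.
rewrite (leq_trans (leq_subr _ _)) // dvdn_leq //.
exact/min_period_dvd/period_exponent.
Qed.

(** The flag [b] lets one induction produce preimages both of an atom ([b] true, [s] all other
    indices) and of the empty set ([b] false, [s] all indices). Each index of [s] contributes one
    factor of a meet. *)
Lemma cube_map_avoid (b : bool) (i : 'I_d) (s : seq 'I_d) : (b -> i \notin s) ->
  exists z, (b -> i \in (cube_map z : {set 'I_d})) /\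
    {in s, forall j, j \notin (cube_map z : {set 'I_d})}.
Proof.
have [x [y /andP[px npy]]] := phi_nonconst; have [_ hM _] := cube_map_hom.
elim: s => [_|j s IH ijs].
  by have [z Ez] := cube_map_value i x; exists z; rewrite Ez px.
have [z [iz sz]] : exists z, (b -> i \in (cube_map z : {set 'I_d})) /\
    {in s, forall j, j \notin (cube_map z : {set 'I_d})}.
  by apply: IH => /ijs; rewrite inE negb_or => /andP[].
have [w [iw jw]] : exists w, (b -> i \in (cube_map w : {set 'I_d})) /\
    j \notin (cube_map w : {set 'I_d}).
  case: b ijs {IH iz} => [/(_ isT)|_].
    rewrite inE negb_or => /andP[/cube_map_separates[w /andP[iw jw]] _].
    by exists w.
  by have [w Ew] := cube_map_value j y; exists w; rewrite Ew.
exists (meet z w); rewrite hM; split=> [bT|k].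
  by rewrite inE iz ?iw.
rewrite in_cons => /predU1P[->|/sz nkz]; rewrite finset.in_setI negb_and ?nkz //.
by rewrite jw orbT.
Qed.

(** The image is closed under joins and contains the empty set and all atoms. *)
Lemma cube_map_surj : is_surjective cube_map.
Proof.
have [hJ _ _] := cube_map_hom.
have h1 (i : 'I_d) : exists z, cube_map z = [set i]%SET.
  have [|z [iz nz]] := @cube_map_avoid true i (enum (predC1 i)).
    by rewrite mem_enum !inE eqxx.
  exists z; apply/setP => j; rewrite finset.in_set1.
  have [->|nji] := eqVneq j i; first exact: iz.
  by apply/negbTE/nz; rewrite mem_enum.
have h0 : exists z, cube_map z = finset.set0.
  have [//|z [_ nz]] := @cube_map_avoid false (Ordinal min_period_gt0) (enum 'I_d).
  by exists z; apply/setP => j; rewrite finset.in_set0; apply/negbTE/nz; rewrite mem_enum.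
move=> S; have -> : S = [set:: enum (S : {set 'I_d})] by rewrite set_enum.
elim: (enum _) => [|i s [z Ez]]; first by rewrite finset.set_nil.
have [w Ew] := h1 i; exists (join w z).
by rewrite hJ Ez Ew finset.set_cons.
Qed.

End CubeQuotient.

Lemma DRL_cube_separation (A : algebra) n (x y : A) : 0 < n -> DRL n A -> x <> y ->
  exists (d : nat) (h : A -> cube d),
    [/\ 0 < d, d %| n, is_hom h, is_surjective h & h x <> h y].
Proof.
move=> n_gt0 drlA nxy; have [[[latA _ _] distrA] _] := drlA.
have [phi [phiJ phiM sep]] := separating_character latA distrA nxy.
exists (min_period n_gt0 drlA phi), (@cube_map A n n_gt0 drlA phi); split.
- exact: min_period_gt0.
- exact/min_period_dvd/period_exponent.
- exact: cube_map_hom.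
- apply: cube_map_surj => //.
  by case px: (phi x) sep; case py: (phi y) => // _;
    [exists x, y|exists y, x]; rewrite px py.
(* Coordinate 0 has exponent [d], so by periodicity it reads [phi] itself. *)
- move=> /setP /(_ (Ordinal (min_period_gt0 n_gt0 drlA phi))).
  by rewrite !inE subn0 !period_min => /eqP; apply/negP.
Qed.

(** * Cubes *)

Lemma cube_iter_set1 n (i : 'I_n) k :
  iter k (@gop (cube n)) [set i]%SET = [set iter k (@ordS n) i]%SET.
Proof. by elim: k => //= k ->; rewrite finset.imset_set1. Qed.

Lemma val_iter_ordS n (i : 'I_n) k : iter k (@ordS n) i = (i + k) %% n :> nat.
Proof.
elim: k => [|k IH] /=; first by rewrite addn0 modn_small.
by rewrite IH -addn1 modnDml addn1 addnS.
Qed.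

Lemma iter_ordS_dvd n m (i : 'I_n) : n %| m -> iter m (@ordS n) i = i.
Proof.
move=> /dvdnP[q ->]; apply: val_inj => /=.
by rewrite val_iter_ordS addnC modnMDl modn_small.
Qed.

Lemma cube_iter_imset n k (x : cube n) :
  iter k (@gop (cube n)) x = (iter k (@ordS n) @: (x : {set 'I_n}))%SET.
Proof.
elim: k => /= [|k ->]; first by rewrite finset.imset_id.
by rewrite -imset_comp.
Qed.

Lemma cube_DRL n m : 0 < m -> n %| m -> DRL m (cube n).
Proof.
move=> m_gt0 nm.
have gm (x : cube n) : iter m (@gop (cube n)) x = x.
  rewrite cube_iter_imset; transitivity (id @: (x : {set 'I_n}))%SET; last exact: finset.imset_id.
  by apply: eq_imset => i; exact: iter_ordS_dvd.
split; last exact: gm; split; last by move=> x y z; exact: finset.setIUr.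
split; last by exists m.
- by split; split=> x y; try move=> z; apply/setP => i; rewrite !inE;
    do ?[case: (i \in _) => //=].
- split.
  + exists (iter m.-1 (@gop (cube n))) => x.
      by rewrite -iterSr prednK.
    by rewrite -iterS prednK.
  + by move=> x y; exact: finset.imsetU.
  + by move=> x y; apply: finset.imsetI => i j _ _; exact: ordS_inj.
Qed.

Lemma cube_exponent_dvd n m :
  0 < n -> (forall x : cube n, iter m (@gop (cube n)) x = x) -> n %| m.
Proof.
move=> n_gt0 /(_ [set Ordinal n_gt0]%SET); rewrite cube_iter_set1 => /set1_inj.
by move=> /(congr1 val); rewrite /= val_iter_ordS add0n => /eqP.
Qed.

(** Meeting two distinct congruent sets with an atom inside just one of them makes that atom
    congruent to the empty set; rotation spreads this to all atoms and joins to all sets. *)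
Lemma cube_simple n : 0 < n -> simple (cube n).
Proof.
move=> n_gt0; split.
  exists finset.set0, [set Ordinal n_gt0]%SET => /setP /(_ (Ordinal n_gt0)).
  by rewrite finset.in_set0 finset.set11.
move=> th [eq_th thJ thM thG].
have thr x : th x x by case: eq_th.
have ths x y : th x y -> th y x by case: eq_th => _ + _; apply.
have tht x y z : th x y -> th y z -> th x z by case: eq_th => _ _; apply.
have [triv|] := pselect (forall x y, th x y -> x = y).
  by left=> x y; split=> [/triv//|->].
move=> /existsNP[x /existsNP[y /not_implyP[xy nxy]]]; right.
have [i th_i] : exists i : 'I_n, th [set i]%SET finset.set0.
  have cut (u v : {set 'I_n}) i : th u v -> i \in u -> i \notin v -> th [set i]%SET finset.set0.
    move=> uv iu iv; have := thM _ _ _ _ (thr [set i]%SET) uv.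
    have -> : meet ([set i]%SET : cube n) u = [set i]%SET.
      by apply/finset.setIidPl; rewrite finset.sub1set.
    suff -> : meet ([set i]%SET : cube n) v = finset.set0 by [].
    by apply/setP => j; rewrite !inE; case: eqP => // ->; exact/negbTE.
  have /existsNP[i /eqP nei] : ~ forall i, (i \in (x : {set 'I_n})) = (i \in (y : {set 'I_n})).
    by move=> /setP.
  exists i; case ix: (i \in (x : {set 'I_n})) nei; case iy: (i \in (y : {set 'I_n})) => // _.
    by apply: cut xy ix _; rewrite iy.
  by apply: (cut y x) => //; [exact: ths|rewrite ix].
have th1 (j : 'I_n) : th [set j]%SET finset.set0.
  have it k : th [set iter k (@ordS n) i]%SET finset.set0.
    elim: k => //= k /thG; rewrite /= finset.imset_set1.
    by rewrite imset0.
  (* The rotation taking [i] to [j], with [n] added to keep the difference nonnegative. *)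
  suff -> : j = iter (j + (n - i)) (@ordS n) i by [].
  apply: val_inj; rewrite /= val_iter_ordS addnCA subnKC; last exact: ltnW.
  by rewrite modnDr modn_small.
have th0 (z : cube n) : th z finset.set0.
  have -> : z = [set:: enum (z : {set 'I_n})] by rewrite set_enum.
  elim: (enum _) => [|j s IH]; first by rewrite finset.set_nil.
  rewrite finset.set_cons; have := thJ _ _ _ _ (th1 j) IH.
  by rewrite /= finset.setU0.
by move=> u v; apply: tht (th0 u) (ths _ _ (th0 v)).
Qed.

(** Reduction modulo [n] maps the indices of [cube m] onto those of [cube n] and commutes with the
    cyclic successor; taking preimages along it is the embedding. *)
Lemma cube_embedding n m : 0 < m -> n %| m ->
  exists f : cube n -> cube m, is_hom f /\ injective f.
Proof.
move=> m_gt0 nm; have n_gt0 : 0 < n by exact: dvdn_gt0 nm.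
pose r (i : 'I_m) : 'I_n := Ordinal (ltn_pmod i n_gt0).
have rS i : r (ordS i) = ordS (r i).
  apply: val_inj => /=; rewrite modn_dvdm //.
  by rewrite -addn1 -modnDml addn1.
exists (fun x : cube n => (r @^-1: (x : {set 'I_n}))%SET : cube m); split; first split.
- by move=> x y; exact: finset.preimsetU.
- by move=> x y; exact: finset.preimsetI.
- move=> x; apply/setP => i.
  rewrite -(ord_predK i) mem_imset; last exact: ordS_inj.
  by rewrite !inE rS mem_imset //; exact: ordS_inj.
- move=> x y /setP exy; apply/setP => i.
  pose k : 'I_m := Ordinal (leq_trans (ltn_ord i) (dvdn_leq m_gt0 nm)).
  have rk : r k = i by apply: val_inj; rewrite /= modn_small.
  by have := exy k; rewrite !inE rk.
Qed.

(** * Varieties and identities *)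

Lemma variety_generated K : variety (generated_variety K).
Proof.
split=> [A B f hf sf VA V vV KV|A P hP VA V vV KV|I A VA V vV KV]; have [H S P'] := vV.
- by apply: H hf sf _; exact: VA.
- by apply: S; exact: VA.
- by apply: P' => i; exact: VA.
Qed.

(** [A] is the homomorphic image of the subalgebra [f(A)] of [B] under the inverse of [f]. *)
Lemma variety_embedding V (A B : algebra) (f : A -> B) :
  variety V -> is_hom f -> injective f -> V B -> V A.
Proof.
move=> [HV SV _] [fJ fM fG] inj_f VB.
have im : subuniverse (fun y => exists x, f x = y).
  split=> [|_ _ [x <-] [y <-]|_ _ [x <-] [y <-]|_ [x <-]].
  - by have [x] := carrier_inh A; exists (f x), x.
  - by exists (join x y).
  - by exists (meet x y).
  - by exists (gop x).
pose h (u : subalgebra im) := sval (cid (svalP u)).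
have hK u : f (h u) = sval u by rewrite /h; case: cid.
apply: (HV _ _ h) (SV _ _ im VB).
  by split=> [u v|u v|u]; apply: inj_f; rewrite hK ?fJ ?fM ?fG ?hK.
move=> x; have ex : exists y, f y = f x by exists x.
by exists (exist _ (f x) ex); apply: inj_f; rewrite hK.
Qed.

(** One factor is taken for each pair of distinct elements. The predicate [Q] carries along what is
    required of the factors, such as surjectivity or membership in a variety. *)
Lemma separating_product (A : algebra) (Q : forall B : algebra, (A -> B) -> Prop) :
  (forall x y : A, x <> y ->
    exists (B : algebra) (h : A -> B), [/\ Q B h, is_hom h & h x <> h y]) ->
  exists (I : Type) (B : I -> algebra) (f : A -> product B),
    [/\ forall i, Q (B i) (fun x => f x i), is_hom f & injective f].
Proof.
move=> sep; pose I := {p : A * A | p.1 <> p.2}.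
have sepI (p : I) : {B : algebra & {h : A -> B |
    [/\ Q B h, is_hom h & h (sval p).1 <> h (sval p).2]}}.
  by have /cid[B /cid[h hh]] := sep _ _ (svalP p); exists B, h.
pose h p := sval (projT2 (sepI p)).
have hh p := svalP (projT2 (sepI p)).
exists I, (fun p => projT1 (sepI p)), (fun x p => h p x); split=> [p||x y exy].
- by have [] := hh p.
- by split=> [x y|x y|x]; apply: functional_extensionality_dep => p;
    have [_ [hJ hM hG] _] := hh p; [exact: hJ|exact: hM|exact: hG].
- apply: contrapT => nxy; pose p : I := exist _ (x, y) nxy.
  by have [_ _] := hh p; apply; exact: (f_equal (fun u => u p) exy).
Qed.

Inductive term : Type :=
| TVar of nat
| TJoin of term & term
| TMeet of term & term
| TG of term.

Fixpoint eval (A : algebra) (v : nat -> A) (t : term) : A :=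
  match t with
  | TVar k => v k
  | TJoin s u => join (eval v s) (eval v u)
  | TMeet s u => meet (eval v s) (eval v u)
  | TG s => gop (eval v s)
  end.

Lemma hom_eval (A B : algebra) (f : A -> B) (v : nat -> A) t : is_hom f ->
  f (eval v t) = eval (f \o v) t.
Proof.
by move=> [fJ fM fG]; elim: t => //= [s <- u <-|s <- u <-|s <-].
Qed.

Definition identity (e : term * term) (A : algebra) : Prop :=
  forall v : nat -> A, eval v e.1 = eval v e.2.

Fixpoint models (E : seq (term * term)) (A : algebra) : Prop :=
  if E is e :: E' then identity e A /\ models E' A else True.

Lemma variety_identity e : variety (identity e).
Proof.
split=> [A B f hf sf eA v|A P hP eA v|I A eA v].
- pose w k := sval (cid (sf (v k))).
  have -> : v = f \o w by apply: funext => k; rewrite /= /w; case: cid.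
  by rewrite -!hom_eval // eA.
- have sv : @is_hom (subalgebra hP) A sval by [].
  have sI : injective (@sval A P).
    by move=> [x Px] [y Py] /= exy; subst y; congr exist; exact: Prop_irrelevance.
  by apply: sI; rewrite !(hom_eval _ _ sv) eA.
- apply: functional_extensionality_dep => i.
  have pr : @is_hom (product A) (A i) (fun x => x i) by [].
  by rewrite !(hom_eval _ _ pr) eA.
Qed.

Lemma variety_models E : variety (models E).
Proof.
elim: E => [|e E [HE SE PE]]; first by split.
have [He Se Pe] := variety_identity e.
split=> [A B f hf sf [eA EA]|A P hP [eA EA]|I A mA]; split.
- exact: (He _ _ f).
- exact: (HE _ _ f).
- exact: Se.
- exact: SE.
- by apply: Pe => i; have [] := mA i.
- by apply: PE => i; have [] := mA i.
Qed.

(** Bijectivity of [gop] is encoded by the last identity, which for positive [n] makes its [n.-1]-st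
    iterate an inverse. *)
Definition DRL_identities (n : nat) : seq (term * term) :=
  let x := TVar 0 in let y := TVar 1 in let z := TVar 2 in
  [:: (TJoin x y, TJoin y x); (TMeet x y, TMeet y x);
      (TJoin x (TJoin y z), TJoin (TJoin x y) z);
      (TMeet x (TMeet y z), TMeet (TMeet x y) z);
      (TJoin x (TMeet x y), x); (TMeet x (TJoin x y), x);
      (TMeet x (TJoin y z), TJoin (TMeet x y) (TMeet x z));
      (TG (TJoin x y), TJoin (TG x) (TG y));
      (TG (TMeet x y), TMeet (TG x) (TG y));
      (iter n TG x, x)].

Lemma eval_iter_TG (A : algebra) (v : nat -> A) n t :
  eval v (iter n TG t) = iter n (@gop A) (eval v t).
Proof. by elim: n => //= n ->. Qed.

Lemma DRL_models n A : 0 < n -> DRL n A <-> models (DRL_identities n) A.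
Proof.
move=> n_gt0; split.
  move=> [[[[[jC mC] [jA mA] [jK mK]] [_ gJ gM] _] dA] gn].
  split; first by move=> v; exact: jC.
  split; first by move=> v; exact: mC.
  split; first by move=> v; exact: jA.
  split; first by move=> v; exact: mA.
  split; first by move=> v; exact: jK.
  split; first by move=> v; exact: mK.
  split; first by move=> v; exact: dA.
  split; first by move=> v; exact: gJ.
  split; first by move=> v; exact: gM.
  by split=> // v; rewrite eval_iter_TG gn.
move=> [jC [mC [jA [mA [jK [mK [dA [gJ [gM [gn _]]]]]]]]]].
have {}gn x : iter n (@gop A) x = x.
  by have := gn (fun=> x); rewrite eval_iter_TG.
pose v (x y z : A) := nth x [:: x; y; z].
split=> //; split; last by move=> x y z; exact: (dA (v x y z)).
split; last by exists n.
- split; split=> [x y|x y].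
  + exact: (jC (v x y x)).
  + exact: (mC (v x y x)).
  + by move=> z; exact: (jA (v x y z)).
  + by move=> z; exact: (mA (v x y z)).
  + exact: (jK (v x y x)).
  + exact: (mK (v x y x)).
- split=> [|x y|x y]; [|exact: (gJ (v x y x))|exact: (gM (v x y x))].
  exists (iter n.-1 (@gop A)) => x; first by rewrite -iterSr prednK.
  by rewrite -iterS prednK.
Qed.

Lemma variety_DRL n : 0 < n -> variety (DRL n).
Proof.
move=> n_gt0; suff -> : DRL n = models (DRL_identities n) by exact: variety_models.
by apply: funext => A; apply: propext; exact: DRL_models.
Qed.

(** * Varieties generated by cubes *)

Lemma Var_cube (X : set nat) n : X n -> Var X (cube n).
Proof. by move=> Xn V _; apply; exists n. Qed.

Lemma Var_DRL (X : set nat) m : 0 < m -> (forall n, X n -> n %| m) ->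
  forall A, Var X A -> DRL m A.
Proof.
move=> m_gt0 Xm A; apply; first exact: variety_DRL.
by move=> _ [n [/Xm nm ->]]; exact: cube_DRL.
Qed.

(** [A] embeds into a product of its cube quotients of dimension dividing [m]. *)
Lemma DRL_sub_variety V m A : variety V -> 0 < m -> DRL m A ->
  (forall d (h : A -> cube d), 0 < d -> d %| m -> is_hom h -> is_surjective h ->
    V (cube d)) -> V A.
Proof.
move=> vV m_gt0 drlA VA; have [_ _ PV] := vV.
have [|I [B [f [VB hf inj_f]]]] := @separating_product A (fun B _ => V B).
  move=> x y nxy.
  have [d [h [d_gt0 dm hh sh nh]]] := DRL_cube_separation m_gt0 drlA nxy.
  by exists (cube d), h; split=> //; exact: VA hh sh.
exact: variety_embedding vV hf inj_f (PV _ _ VB).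
Qed.

Lemma fin_div_ideal_bound (X : set nat) : fin_div_ideal X ->
  exists2 m, 0 < m & forall n, X n -> n %| m.
Proof.
move=> [X_gt0 /finite_seqP[s Es] _]; exists (\prod_(k <- s) k).
  rewrite big_seq; apply: prodn_cond_gt0 => k ks.
  by apply: X_gt0; rewrite Es.
move=> n; rewrite Es /= => ns; rewrite (big_rem n) //=; exact: dvdn_mulr.
Qed.

(* The inequality [x <= y \/ g^k1 x \/ ... \/ g^kr x], for [s = [:: k1; ...; kr]],
   holds in [cube m] for [m \in s], but fails in [cube n], at a singleton [x] and
   [y] empty, when [n] divides no member of [s]. *)
Definition cover_term (s : seq nat) : term :=
  foldr (fun k t => TJoin (iter k TG (TVar 0)) t) (TVar 1) s.

Definition cover_identity (s : seq nat) : term * term :=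
  (TMeet (TVar 0) (cover_term s), TVar 0).

Lemma mem_cover n (s : seq nat) (v : nat -> cube n) (i : 'I_n) :
  i \in (eval v (cover_term s) : {set 'I_n}) =
  (i \in (v 1 : {set 'I_n})) ||
  has (fun k => i \in (iter k (@gop (cube n)) (v 0) : {set 'I_n})) s.
Proof.
elim: s => [|k s IH] /=; first by rewrite orbF.
by rewrite inE IH eval_iter_TG orbCA.
Qed.

Lemma cube_cover n (s : seq nat) : n \in s -> 0 < n ->
  identity (cover_identity s) (cube n).
Proof.
move=> ns n_gt0 v /=; apply/finset.setIidPl/fintype.subsetP => i iv.
rewrite mem_cover; apply/orP; right; apply/hasP; exists n => //.
by have [_ ->] := cube_DRL n_gt0 (dvdnn n).
Qed.

Lemma cube_cover_dvd n (s : seq nat) : 0 < n ->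
  identity (cover_identity s) (cube n) -> exists2 k, k \in s & n %| k.
Proof.
move=> n_gt0; pose i0 := Ordinal n_gt0.
move=> /(_ (fun k => if k is 0 then [set i0]%SET else finset.set0)) /=.
move=> /finset.setIidPl; rewrite finset.sub1set mem_cover finset.in_set0 /= => /hasP[k ks].
(* Rotating the singleton of index 0 by [k] steps gives that of [k %% n], which contains 0 only if
   [n] divides [k]. *)
rewrite cube_iter_set1 finset.in_set1 => /eqP /(congr1 val) /=.
rewrite val_iter_ordS add0n => /esym/eqP kn.
by exists k.
Qed.

(** The cover identity for a list of [Y] holds throughout [Var Y], so for [n] in [X] it holds in
    [cube n]; then [n] divides a member of [Y] and lies in [Y]. *)
Lemma Var_sub (X Y : set nat) : fin_div_ideal X -> fin_div_ideal Y ->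
  (forall A, Var X A -> Var Y A) <-> (X `<=` Y)%classic.
Proof.
move=> [X_gt0 _ _] [Y_gt0 /finite_seqP[s Es] Y_dvd]; split=> [XY n Xn|XY A VA V vV YV].
  have [k ks nk] : exists2 k, k \in s & n %| k.
    apply: cube_cover_dvd (X_gt0 _ Xn) _.
    apply: (XY _ (Var_cube Xn)); first exact: variety_identity.
    by move=> _ [k [Yk ->]]; apply: cube_cover (Y_gt0 _ Yk); rewrite Es in Yk.
  by apply: Y_dvd nk; rewrite Es.
by apply: VA => // _ [n [Xn ->]]; apply: YV; exists n; split=> //; exact: XY.
Qed.

Lemma variety_of_DRLs_Var (X : set nat) : fin_div_ideal X -> variety_of_DRLs (Var X).
Proof.
move=> iX; split; first exact: variety_generated.
have [m m_gt0 Xm] := fin_div_ideal_bound iX.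
by move=> A /(Var_DRL m_gt0 Xm)[].
Qed.

(** The product of all positive-dimensional cubes in [V] is again in [V], so some single power of
    its [gop] is the identity; every factor inherits this exponent. *)
Lemma variety_of_DRLs_exponent V : variety_of_DRLs V ->
  exists2 m, 0 < m & forall n, 0 < n -> V (cube n) -> n %| m.
Proof.
move=> [[_ _ PV] VD]; pose I := {n | 0 < n /\ V (cube n)}.
have /VD[[_ _ [m [m_gt0 gm]]] _] : V (product (fun i : I => cube (sval i))).
  by apply: PV => -[n []].
exists m => // n n_gt0 Vn; apply: cube_exponent_dvd => // x.
pose i : I := exist _ n (conj n_gt0 Vn).
(* [w] has [x] at coordinate [i] and the empty set elsewhere. *)
pose w : product (fun i : I => cube (sval i)) := fun j =>
  if pselect (i = j) is left e then ecast j (cube (sval j)) e x else finset.set0.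
have wi : w i = x.
  by rewrite /w; case: pselect => // e; rewrite (Prop_irrelevance e erefl).
have it k : iter k (@gop (product (fun i : I => cube (sval i)))) w i
          = iter k (@gop (cube n)) (w i).
  by elim: k => //= k ->.
by rewrite -wi -it gm.
Qed.

(** [X] collects the dimensions of the cubes in [V]: the common exponent makes it finite, embeddings
    of cubes make it closed under divisors, and each [A] in [V] is recovered from its cube
    quotients, which lie in [V]. *)
Lemma variety_of_DRLs_classification V : variety_of_DRLs V ->
  exists X, fin_div_ideal X /\ forall A, V A <-> Var X A.
Proof.
move=> vdV; have [vV VD] := vdV.
have [m m_gt0 Vm] := variety_of_DRLs_exponent vdV.
pose X : set nat := fun n => 0 < n /\ V (cube n).
exists X; split.
  split=> [n []//||n k [n_gt0 Vn] kn].
    apply: (@sub_finite_set _ _ `I_m.+1); last exact: finite_II.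
    by move=> n [n_gt0 Vn] /=; rewrite ltnS dvdn_leq // Vm.
  have [f [hf inj_f]] := cube_embedding n_gt0 kn.
  by split; [exact: dvdn_gt0 kn|exact: variety_embedding hf inj_f Vn].
move=> A; split=> [VA|]; last by apply=> // _ [n [[_ Vn] ->]].
have dA := VD _ VA; have [[_ _ [p [p_gt0 gp]]] _] := dA.
apply: (@DRL_sub_variety _ p) => //; first exact: variety_generated.
move=> d h d_gt0 _ hh sh; apply: Var_cube; split=> //.
by have [HV _ _] := vV; exact: HV hh sh VA.
Qed.

(** * Subdirect irreducibility *)

(** The kernel of each projection is trivial or total; a trivial one gives an isomorphism, and if
    all were total then [f] would be constant. *)
Lemma simple_subdirectly_irreducible A : simple A -> subdirectly_irreducible A.
Proof.
move=> [ntA simA]; split=> // I B f [[fJ fM fG] inj_f sf].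
have hf i : is_hom (fun x => f x i).
  by split=> [x y|x y|x]; rewrite ?fJ ?fM ?fG.
apply: contrapT => /forallNP nif; have [x [y nxy]] := ntA.
apply: nxy; apply: inj_f; apply: functional_extensionality_dep => i.
have [|triv|] := simA (fun u v => f u i = f v i); last by apply.
- have [hJ hM hG] := hf i; split.
  + by split=> // [u v w -> ->].
  + by move=> u u' v v' eu ev; rewrite hJ eu ev -hJ.
  + by move=> u u' v v' eu ev; rewrite hM eu ev -hM.
  + by move=> u u' eu; rewrite hG eu -hG.
- case: (nif i); split=> //.
  pose r z := sval (cid (sf i z)); have rK z : f (r z) i = z by rewrite /r; case: cid.
  by exists r => // u; apply/triv; rewrite rK.
Qed.

Lemma isomorphic_sym A B : isomorphic A B -> isomorphic B A.
Proof.
move=> [f [[fJ fM fG] [h hK fK]]]; exists h; split; last by exists f.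
by split=> [x y|x y|x]; rewrite -[LHS]hK -[RHS]hK ?fJ ?fM ?fG !fK.
Qed.

Lemma simple_iso A B : isomorphic A B -> simple A -> simple B.
Proof.
move=> [f [[fJ fM fG] [h hK fK]]] [[x [y nxy]] simA]; split.
  by exists (f x), (f y) => /(can_inj hK).
move=> th [eq_th thJ thM thG].
have [|triv|full] := simA (fun u v => th (f u) (f v)).
- split.
  + by case: eq_th => r s t; split=> [u|u v|u v w]; [exact: r|exact: s|exact: t].
  + by move=> *; rewrite !fJ; exact: thJ.
  + by move=> *; rewrite !fM; exact: thM.
  + by move=> *; rewrite !fG; exact: thG.
- left=> u v; rewrite -(fK u) -(fK v) triv; split=> [-> //|].
  exact: (can_inj hK).
- by right=> u v; rewrite -(fK u) -(fK v).
Qed.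

Lemma DRL_iso n A B : 0 < n -> isomorphic A B -> DRL n A -> DRL n B.
Proof.
move=> n_gt0 [f [hf [h hK fK]]]; have [HD _ _] := variety_DRL n_gt0.
by apply: HD hf _ => y; exists (h y).
Qed.

(** The separating cube quotients form a subdirect embedding, one of whose projections must be an
    isomorphism. *)
Lemma subdirectly_irreducible_cube A :
  distributive_rotational_lattice A -> subdirectly_irreducible A ->
  exists n, 0 < n /\ isomorphic A (cube n).
Proof.
move=> dA [_ siA]; have [[_ _ [m [m_gt0 gm]]] _] := dA.
have [|I [B [f [cubeB hf inj_f]]]] := @separating_product A
    (fun B h => is_surjective h /\ exists2 d, 0 < d & B = cube d).
  move=> x y nxy.
  have [d [h [d_gt0 _ hh sh nh]]] := DRL_cube_separation m_gt0 (conj dA gm) nxy.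
  by exists (cube d), h; split=> //; split=> //; exists d.
have [|i iso] := siA I B f; first by split=> // i; have [] := cubeB i.
have [_ [d d_gt0 Ed]] := cubeB i.
by exists d; split=> //; rewrite -Ed; exists (fun x => f x i).
Qed.

Local Open Scope classical_set_scope.

Theorem theorem2p1 :
  (* (i) *)
  ((forall A : algebra,
      (distributive_rotational_lattice A /\ subdirectly_irreducible A) <->
      (exists n : nat, 0 < n /\ isomorphic A (cube n))) /\
   (forall n : nat, 0 < n -> simple (cube n))) /\
  (* (ii) *)
  ((forall V : algebra -> Prop,
      variety_of_DRLs V <->
      (exists X : set nat, fin_div_ideal X /\ forall A, V A <-> Var X A)) /\
   (forall X Y : set nat, fin_div_ideal X -> fin_div_ideal Y ->
      ((forall A, Var X A -> Var Y A) <-> X `<=` Y))) /\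
  (* (iii) *)
  (forall n : nat, 0 < n ->
     forall A, DRL n A <-> Var [set x | 0 < x /\ x %| n] A).
Proof.
split; [split|split; [split|]].
- move=> A; split=> [[]|[n [n_gt0 /isomorphic_sym iso]]].
    exact: subdirectly_irreducible_cube.
  split; first by have [] := DRL_iso n_gt0 iso (cube_DRL n_gt0 (dvdnn n)).
  exact/simple_subdirectly_irreducible/(simple_iso iso)/cube_simple.
- exact: cube_simple.
- move=> V; split=> [|[X [iX VX]]]; first exact: variety_of_DRLs_classification.
  suff -> : V = Var X by exact: variety_of_DRLs_Var.
  by apply: funext => A; apply: propext.
- exact: Var_sub.
- move=> n n_gt0 A; split=> [drlA|].
    apply: (DRL_sub_variety (variety_generated _) n_gt0 drlA) => d h d_gt0 dn _ _.
    exact: Var_cube.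
  by apply: Var_DRL => // d [].
Qed.
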